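(* Let $X$ be an extremally disconnected Stone space. The following are equivalent: (1) the frame $\mathcal{CCR}(X)$ of cocontinuous relations on $X$ is a spatial frame; (2) the isolated points of $X$ are dense in $X$; (3) $X$ is homeomorphic to the Stone-Čech compactification $\beta M$ of some set $M$ (regarded as a discrete space).
   Context: A Stone space is a compact Hausdorff zero-dimensional space; a space is extremally disconnected if the closure of each open set is open. A binary relation $R$ on a Stone space $X$ is continuous if $R[x]=\{y : x\mathrel{R}y\}$ is closed for each $x\in X$ and $R^{-1}[U]=\{x : x \mathrel{R} y \text{ for some } y\in U\}$ is clopen for each clopen $U\subseteq X$. A relation on $X$ is cocontinuous if it is the set-theoretic complement in $X\times X$ of a continuous relation on $X$. $\mathcal{CCR}(X)$ is the set of cocontinuous relations on $X$, ordered by inclusion; for $X$ extremally disconnected it is a frame. A frame is a complete lattice $L$ satisfying $a\wedge\bigvee S=\bigvee\{a\wedge b\mid b\in S\}$ for all $a\in L$, $S\subseteq L$. A frame is spatial if it is isomorphic to the frame of open sets of a topological space. *)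

(* Defs.v *)
From HB Require Import structures.
From mathcomp Require Import all_boot all_order.
From mathcomp Require Import all_classical.
From mathcomp Require Import topology.

Set Implicit Arguments.
Unset Strict Implicit.
Unset Printing Implicit Defensive.

Local Open Scope classical_set_scope.

(* Zero-dimensionality means that the clopen sets form a base; the library's
   [zero_dimensional] only asks that clopen sets separate points. *)
Definition stone_space (X : topologicalType) : Prop :=
  [/\ compact [set: X], hausdorff_space X & basis [set U : set X | clopen U]].

Definition extremally_disconnected (X : topologicalType) : Prop :=
  forall U : set X, open U -> open (closure U).

Definition isolated_points (X : topologicalType) : set X := isolated [set: X].
Arguments isolated_points X : clear implicits.

Definition homeomorphic (X Y : topologicalType) : Prop :=
  exists (f : X -> Y) (g : Y -> X),
    [/\ cancel f g, cancel g f, continuous f & continuous g].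

(* A relation R on X is the set of the pairs (x, y) with x R y, so that
   [xsection R x] is R[x]. *)
Definition continuous_relation (X : topologicalType) (R : set (X * X)) : Prop :=
  (forall x : X, closed (xsection R x)) /\
  (forall U : set X, clopen U -> clopen [set x | exists2 y, U y & R (x, y)]).

Definition cocontinuous_relation (X : topologicalType) (R : set (X * X)) :
    Prop :=
  exists2 S : set (X * X), continuous_relation S & R = ~` S.

(* The order inherited from [set (X * X)] is inclusion. *)
Definition CCR (X : topologicalType) : Type :=
  set_type [set R : set (X * X) | cocontinuous_relation R].
HB.instance Definition _ (X : topologicalType) := SubChoice.on (CCR X).
HB.instance Definition _ (X : topologicalType) :=
  [SubChoice_isSubPOrder of CCR X by <: with set_display].

Definition opens (Y : topologicalType) : Type :=
  set_type [set U : set Y | open U].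
HB.instance Definition _ (Y : topologicalType) := SubChoice.on (opens Y).
HB.instance Definition _ (Y : topologicalType) :=
  [SubChoice_isSubPOrder of opens Y by <: with set_display].

Section Frames.
Context {d d' : Order.disp_t}.

Definition complete_lattice (L : porderType d) : Prop :=
  forall S : set L, supremums S !=set0 /\ infimums S !=set0.

(* If s is the join of S and m = a /\ s, then m is the join of the a /\ b for
   b in S. *)
Definition is_frame (L : porderType d) : Prop :=
  complete_lattice L /\
  forall (a : L) (S : set L) (s m : L),
    supremums S s -> infimums [set a; s] m ->
    supremums [set c | exists2 b, S b & infimums [set a; b] c] m.

(* The empty S gives the preservation of the bottom and top elements. *)
Definition frame_morphism (L : porderType d) (L' : porderType d')
    (f : L -> L') : Prop :=
  (forall (S : set L) (s : L), supremums S s -> supremums (f @` S) (f s)) /\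
  (forall (S : set L) (m : L), finite_set S ->
     infimums S m -> infimums (f @` S) (f m)).

(* Between frames, the inverse of a bijective morphism is again a morphism. *)
Definition frame_isomorphism (L : porderType d) (L' : porderType d')
    (f : L -> L') : Prop :=
  bijective f /\ frame_morphism f.

End Frames.

Definition spatial_frame {d : Order.disp_t} (L : porderType d) : Prop :=
  is_frame L /\
  exists (Y : topologicalType) (f : L -> opens Y), frame_isomorphism f.

(* The Stone-Cech compactification of T, characterised up to homeomorphism by
   its universal property among the compact Hausdorff spaces. *)
Definition is_stone_cech (T K : topologicalType) (i : T -> K) : Prop :=
  [/\ compact [set: K], hausdorff_space K, continuous i &
      forall (Z : topologicalType) (f : T -> Z),
        compact [set: Z] -> hausdorff_space Z -> continuous f ->
        exists! g : K -> Z, continuous g /\ g \o i = f].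

(* Main.v *)
Require Import Defs.
From mathcomp Require Import all_boot all_order.
From mathcomp Require Import all_classical.
From mathcomp Require Import topology.

(* Write M for the set of isolated points of X, which is open and discrete.

   (2) => (1): a continuous relation S on a Stone space is closed in X * X, and
   when M is dense S is the closure of its restriction to M * X, because the
   preimages of clopen sets are clopen.  Conversely the closure of any closed
   subset of M * X is a continuous relation, as X is compact and extremally
   disconnected.  So CCR(X) is isomorphic to the frame of open sets of M * X.

   (1) => (2): the cylinders d * X, for d clopen, form a copy of the complete
   Boolean algebra of clopen sets inside CCR(X).  A point of a space
   representing CCR(X) induces a completely prime filter on it, that is, an
   atom, and an atom is an isolated point.

   (2) => (3): X is itself the compactification of M; disjoint subsets of M have
   disjoint closures, so f : M -> Z has a unique cluster value at each x.

   (3) => (2): extend the indicator functions M -> bool. *)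

Set Implicit Arguments.
Unset Strict Implicit.
Unset Printing Implicit Defensive.

Local Open Scope classical_set_scope.

(** * Transport of frame structure along order isomorphisms *)

Section OrderIsomorphism.
Context {d d' : Order.disp_t} {L : porderType d} {L' : porderType d'}.
Variables (f : L -> L') (g : L' -> L).
Hypotheses (fK : cancel f g) (gK : cancel g f).
Hypothesis f_mono : {mono f : x y / (x <= y)%O}.

Lemma supremums_image (S : set L) (s : L) :
  supremums S s <-> supremums (f @` S) (f s).
Proof.
split=> -[ub lub]; split.
- by move=> _ [x Sx <-]; rewrite f_mono; exact: ub.
- move=> y uby; rewrite -[y]gK f_mono; apply: lub => x Sx.
  by rewrite -f_mono gK; apply: uby; exists x.
- by move=> x Sx; rewrite -f_mono; apply: ub; exists x.
- move=> y uby; rewrite -f_mono; apply: lub => _ [x Sx <-].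
  by rewrite f_mono; exact: uby.
Qed.

Lemma infimums_image (S : set L) (m : L) :
  infimums S m <-> infimums (f @` S) (f m).
Proof.
split=> -[lb glb]; split.
- by move=> _ [x Sx <-]; rewrite f_mono; exact: lb.
- move=> y lby; rewrite -[y]gK f_mono; apply: glb => x Sx.
  by rewrite -f_mono gK; apply: lby; exists x.
- by move=> x Sx; rewrite -f_mono; apply: lb; exists x.
- move=> y lby; rewrite -f_mono; apply: glb => _ [x Sx <-].
  by rewrite f_mono; exact: lby.
Qed.

Lemma order_iso_frame_isomorphism : frame_isomorphism f.
Proof.
split; first by exists g.
by split=> [S s /supremums_image | S m _ /infimums_image].
Qed.

Lemma order_iso_is_frame : is_frame L' -> is_frame L.
Proof.
move=> [complete distr]; split=> [S|a S s m].
  have [[s Ss] [m Sm]] := complete (f @` S).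
  by split; [exists (g s); apply/supremums_image|
    exists (g m); apply/infimums_image]; rewrite gK.
have image2 b : f @` [set a; b] = [set f a; f b].
  by rewrite image_setU !image_set1.
move=> /supremums_image Ss /infimums_image; rewrite image2 => am.
apply/supremums_image; have := distr _ _ _ _ Ss am; congr (supremums _ _).
apply/seteqP; split=> [y [_ [b Sb <-]]|_ [c [b Sb abc] <-]].
  rewrite -image2 -{1}[y]gK => /infimums_image aby.
  by exists (g y); [exists b | rewrite gK].
exists (f b); first by exists b.
by rewrite -image2; apply/infimums_image.
Qed.

End OrderIsomorphism.

(** * Joins and meets in the frame of open sets *)

Section Opens.
Context {Y : topologicalType}.
Implicit Types (u v : opens Y) (S : set (opens Y)).

Definition mk_opens (U : set Y) (oU : open U) : opens Y := SigSub (mem_set oU).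

Lemma open_opens u : open (val u). Proof. exact: set_mem (valP u). Qed.

Lemma le_opens u v : (u <= v)%O <-> val u `<=` val v.
Proof. by rewrite -Order.le_val -subsetEset. Qed.

Lemma supremums_opens S u :
  supremums S u <-> val u = \bigcup_(v in S) val v.
Proof.
have oS : open (\bigcup_(v in S) val v).
  by apply: bigcup_open => v _; exact: open_opens.
split=> [[ub lub]|uE].
  apply/seteqP; split; last by move=> y [v /ub /le_opens]; apply.
  apply/(@le_opens u (mk_opens oS))/lub => v Sv.
  by apply/le_opens => y vy; exists v.
split=> [v Sv|w ubw]; apply/le_opens; rewrite uE.
  by move=> y vy; exists v.
by move=> y [v /ubw /le_opens]; apply.
Qed.

Lemma infimums_opens S u :
  infimums S u <-> val u = (\bigcap_(v in S) val v)°.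
Proof.
have oS : open (\bigcap_(v in S) val v)° by exact: open_interior.
split=> [[lb glb]|uE].
  apply/seteqP; split.
    rewrite -open_subsetE; last exact: open_opens.
    by move=> y uy v Sv; have /le_opens := lb v Sv; apply.
  apply/(@le_opens (mk_opens oS) u)/glb => v Sv.
  by apply/le_opens => y /interior_subset /(_ v Sv).
split=> [v Sv|w lbw]; apply/le_opens; rewrite uE.
  by move=> y /interior_subset /(_ v Sv).
rewrite -open_subsetE; last exact: open_opens.
by move=> y wy v Sv; have /le_opens := lbw v Sv; apply.
Qed.

Lemma infimums2_opens u v w :
  infimums [set u; v] w <-> val w = val u `&` val v.
Proof.
rewrite infimums_opens bigcap_setU !bigcap_set1.
suff -> : (val u `&` val v)° = val u `&` val v by [].
by apply/interior_id; apply: openI; exact: open_opens.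
Qed.

Lemma is_frame_opens : is_frame (opens Y).
Proof.
split=> [S|a S s m].
  have oU : open (\bigcup_(v in S) val v).
    by apply: bigcup_open => v _; exact: open_opens.
  split; first by exists (mk_opens oU); apply/supremums_opens.
  exists (mk_opens (open_interior (\bigcap_(v in S) val v))).
  exact/infimums_opens.
move=> /supremums_opens sE /infimums2_opens mE; apply/supremums_opens.
rewrite mE sE setI_bigcupr; apply/seteqP; split=> y.
  move=> [v Sv avy]; have oav := openI (open_opens a) (open_opens v).
  by exists (mk_opens oav) => //; exists v => //; apply/infimums2_opens.
by move=> [c [b Sb /infimums2_opens ->] aby]; exists b.
Qed.

End Opens.

Lemma order_iso_opens_spatial {d} {L : porderType d} {Y : topologicalType}
    (f : L -> opens Y) (g : opens Y -> L) :
  cancel f g -> cancel g f -> {mono f : x y / (x <= y)%O} -> spatial_frame L.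
Proof.
move=> fK gK f_mono; split.
  exact: (order_iso_is_frame gK f_mono is_frame_opens).
by exists Y, f; exact: (order_iso_frame_isomorphism fK gK f_mono).
Qed.

(** * Cocontinuous relations and isolated points *)

Section CCROrder.
Context {X : topologicalType}.

Definition mk_CCR (R : set (X * X)) (cR : cocontinuous_relation R) : CCR X :=
  SigSub (mem_set cR).

Lemma CCR_cocontinuous (r : CCR X) : cocontinuous_relation (val r).
Proof. exact: set_mem (valP r). Qed.

Lemma le_CCR (r s : CCR X) : (r <= s)%O <-> val r `<=` val s.
Proof. by rewrite -Order.le_val -subsetEset. Qed.

End CCROrder.

Section IsolatedPoints.
Context {X : topologicalType}.

Lemma isolated_pointsP (x : X) : isolated_points X x <-> open [set x].
Proof.
split=> [[_ [V nV]]|ox].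
  rewrite setIT => VE; rewrite openE => _ ->.
  by rewrite /interior -VE.
split; first exact: in_setT.
by exists [set x]; rewrite ?setIT //; exact: open_nbhs_nbhs.
Qed.

Lemma open_sub_isolated (A : set X) : A `<=` isolated_points X -> open A.
Proof.
move=> AI; rewrite openE => x /[dup] Ax /AI /isolated_pointsP ox.
by apply: filterS (open_nbhs_nbhs (conj ox erefl)) => _ ->.
Qed.

End IsolatedPoints.

(** * Continuous relations as closed subsets of the square *)

Section ContinuousRelations.
Context {X : topologicalType}.
Hypothesis clopen_basis : basis [set U : set X | clopen U].

Lemma nbhs_clopen (x : X) (U : set X) :
  nbhs x U -> exists V, [/\ clopen V, V x & V `<=` U].
Proof. by move=> /(proj2 clopen_basis) [V [cV Vx] VU]; exists V. Qed.

(** A tube-lemma argument: compactness of the second factor lets projection commute with closure,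
    and clopenness of [U] keeps the limit point in [U]. *)
Lemma closure_preimage (F : set (X * X)) (x : X) (U : set X) :
  compact [set: X] -> clopen U ->
  closure [set m | exists2 y, U y & F (m, y)] x <->
  exists2 y, U y & closure F (x, y).
Proof.
move=> cptX [oU clU]; split=> [xcl|[y Uy clF] V nV]; last first.
  have [[m y'] [/= Fmy [Vm Uy']]] : F `&` (V `*` U) !=set0.
    by apply: clF; exists (V, U) => //; split => //; exact: open_nbhs_nbhs.
  by exists m; split => //; exists y'.
(* As [V] shrinks to [x], the sets [B V] generate a proper filter; any cluster point of it is the
   [y] sought. *)
pose B V := U `&` [set y | exists2 m, V m & F (m, y)].
have FB : Filter (filter_from (nbhs x) B).
  apply: filter_from_filter; first by exists setT; exact: filterT.
  move=> V W nV nW; exists (V `&` W); first exact: filterI.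
  by move=> y [Uy [m [Vm Wm] Fmy]]; split; split => //; exists m.
have PB : ProperFilter (filter_from (nbhs x) B).
  apply: filter_from_proper => V /xcl [m [[y Uy Fmy] Vm]].
  by exists y; split => //; exists m.
have [y [_ cly]] := cptX _ PB filterT.
have nB V : nbhs x V -> filter_from (nbhs x) B (B V) by exists V.
exists y.
  rewrite ((closure_id _).1 clU) => W nW.
  by have [z [[Uz _] Wz]] := cly _ _ (nB _ filterT) nW; exists z.
move=> W [[V1 V2] [/= nV1 nV2] V12].
have [z [[Uz [m V1m Fmz]] V2z]] := cly _ _ (nB _ nV1) nV2.
by exists (m, z); split => //; apply: V12.
Qed.

(** The preimage of a clopen set under [closure F] is the closure of a set of isolated points. Such
    a set is open, so extremal disconnectedness makes its closure clopen. *)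
Lemma closure_continuous_relation (F : set (X * X)) :
  compact [set: X] -> extremally_disconnected X ->
  (forall m y, F (m, y) -> isolated_points X m) ->
  continuous_relation (closure F).
Proof.
move=> cptX edX FI; split=> [x|U cU].
  rewrite xsectionE; apply: preimage_closed (@closed_closure _ F) => y _.
  exact: cvg_pair (cvg_cst x) cvg_id.
have -> : [set x | exists2 y, U y & closure F (x, y)] =
    closure [set m | exists2 y, U y & F (m, y)].
  by apply/seteqP; split=> x /=; rewrite closure_preimage.
split; last exact: closed_closure.
by apply: edX; apply: open_sub_isolated => m [y _ /FI].
Qed.

(** If [y] is outside the closed set S[x], some clopen [U] around [y] misses S[x]; the complement of
    the preimage of [U], times [U], is then a neighbourhood of (x, y) disjoint from [S]. *)
Lemma continuous_relation_closed (S : set (X * X)) :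
  continuous_relation S -> closed S.
Proof.
move=> [clS cS] [x y] clSxy; apply: contrapT => nSxy.
have [U [cU Uy US]] : exists U, [/\ clopen U, U y & U `<=` ~` xsection S x].
  apply/nbhs_clopen/open_nbhs_nbhs; split; first by rewrite openC.
  by rewrite /= /xsection /= inE.
have [_ clV] := cS U cU.
have [[x' y'] [/= Sxy [nSx' Uy']]] :
    S `&` (~` [set x | exists2 y, U y & S (x, y)] `*` U) !=set0.
  apply: clSxy; exists (~` [set x | exists2 y, U y & S (x, y)], U) => //.
  split; apply: open_nbhs_nbhs; split => //=; [by rewrite openC| |by case: cU].
  by move=> [z Uz Sxz]; apply: US Uz _; rewrite /xsection /= inE.
by apply: nSx'; exists y'.
Qed.

Lemma continuous_relation_closure_isolated (S : set (X * X)) :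
  dense (isolated_points X) -> continuous_relation S ->
  closure (S `&` (isolated_points X `*` [set: X])) = S.
Proof.
move=> dX cS; apply/seteqP; split.
  rewrite [X in _ `<=` X]((closure_id _).1 (continuous_relation_closed cS)).
  by apply: closureS; exact: subIsetl.
move=> [x y] Sxy W [[V0 U0] [/= nV0 /nbhs_clopen [U [cU Uy UU0]]] V0U0].
move: nV0; rewrite nbhsE => -[V [oV Vx] VV0].
(* For a box V * U around a pair of [S], the part of [V] lying in the preimage of [U] is open and
   contains [x], so it contains an isolated point. *)
have [m [[Vm [z Uz Smz]] Im]] :
    V `&` [set x | exists2 y, U y & S (x, y)] `&` isolated_points X !=set0.
  apply: dX; first by exists x; split => //; exists y.
  by apply: openI => //; case: (cS.2 U cU).
exists (m, z); split => //; apply: V0U0.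
by split => /=; [exact: VV0 | exact: UU0].
Qed.

End ContinuousRelations.

(** * Dense isolated points make the frame spatial *)

Section OpensOfCCR.
Context {X : topologicalType}.
Hypotheses (stoneX : stone_space X) (edX : extremally_disconnected X).
Hypothesis dX : dense (isolated_points X).

Let M := discrete_topology (set_type (isolated_points X)).
Let j (p : M * X) : X * X := (val p.1, p.2).

Let j_continuous : continuous j.
Proof.
move=> [m y] W [[A B] [/= nA nB] ABW].
exists ([set m], B); first by split => //; exact: discrete_set1.
by move=> [_ y'] [/= -> By']; apply: ABW; split => //=; exact: nbhs_singleton.
Qed.

Lemma open_CCR (r : CCR X) : open (val r).
Proof.
have [S cS ->] := CCR_cocontinuous r; rewrite openC.
by apply: continuous_relation_closed cS; case: stoneX.
Qed.

Lemma open_preimage_CCR (r : CCR X) : open (j @^-1` val r).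
Proof. by have /continuousP := j_continuous; apply; exact: open_CCR. Qed.

Lemma cocontinuous_opens (u : opens (M * X)%type) :
  cocontinuous_relation (~` closure (j @` ~` val u)).
Proof.
exists (closure (j @` ~` val u)) => //.
case: stoneX => cptX _ bX; apply: closure_continuous_relation => // m y.
by move=> [[m' y'] _ [<- _]]; exact: set_mem (valP m').
Qed.

(** The two mutually inverse maps: [f] restricts a relation to M * X, and [g] closes up in X * X the
    complement of an open set. *)
Let f (r : CCR X) : opens (M * X)%type := mk_opens (@open_preimage_CCR r).
Let g (u : opens (M * X)%type) : CCR X := mk_CCR (@cocontinuous_opens u).

Let fK : cancel f g.
Proof.
move=> r; apply/val_inj => /=; have [S cS rE] := CCR_cocontinuous r.
have [_ _ bX] := stoneX.
rewrite [RHS]rE -(continuous_relation_closure_isolated bX dX cS).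
congr (~` closure _); rewrite rE preimage_setC setCK.
apply/seteqP; split=> [_ [[m y] Smy <-]|[m y] [Smy [/= Im _]]].
  by split => //; split => //; exact: set_mem (valP m).
by exists (SigSub (mem_set Im) : M, y).
Qed.

Let gK : cancel g f.
Proof.
move=> u; apply/val_inj; rewrite /= preimage_setC.
apply: setC_inj; rewrite setCK; apply/seteqP; split; last first.
  by move=> p up; apply: subset_closure; exists p.
move=> [m y] cl.
have clu : closed (~` val u) by rewrite closedC; exact: open_opens.
rewrite ((closure_id _).1 clu) => W [[A B] [/= nA nB] ABW].
(* Since [val m] is isolated, closing up in X * X adds no point to the fibre over [m] of a closed
   subset of M * X. *)
have nm : nbhs (val m) [set val m].
  apply: open_nbhs_nbhs; split => //; apply/isolated_pointsP.
  exact: set_mem (valP m).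
have [|_ [[[m' y'] um'y' <-] [/= mm' By']]] := cl ([set val m] `*` B).
  by exists ([set val m], B).
have {}mm' : m' = m.
  exact: (@val_inj _ _ (set_type (isolated_points X))).
rewrite mm' in um'y'.
by exists (m, y'); split => //; apply: ABW; split => //=; exact: nbhs_singleton.
Qed.

Let f_mono : {mono f : r s / (r <= s)%O}.
Proof.
move=> r s; apply/idP/idP => [|/le_CCR rs]; last first.
  by apply/le_opens => p; exact: rs.
rewrite -{2}[r]fK -{2}[s]fK => /le_opens fle; apply/le_CCR.
apply: subsetC; apply: closureS; apply: image_subset; exact: subsetC.
Qed.

Lemma dense_isolated_spatial : spatial_frame (CCR X).
Proof. exact: order_iso_opens_spatial fK gK f_mono. Qed.

End OpensOfCCR.

(** * The clopen algebra inside the cocontinuous relations *)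

Section Cylinders.
Context {X : topologicalType}.
Implicit Types (c d e : set_type (@clopen X)).

(** The complementary relation sends each point to everything or to nothing, so the preimage of [U]
    depends only on whether [U] is empty. *)
Lemma cocontinuous_cylinder c :
  cocontinuous_relation (val c `*` [set: X]).
Proof.
have cc : clopen (val c) := set_mem (valP c).
exists (~` val c `*` setT); last first.
  apply/seteqP; split=> -[x y] /= => [[cx _] []//|ncx].
  by split => //; apply: contrapT => ?; apply: ncx.
split=> [x|U _].
  have [xc|nxc] := pselect (val c x).
    by rewrite notin_xsectionX; [exact: closed0 | rewrite notin_setE; exact].
  by rewrite in_xsectionX ?inE//; exact: closedT.
have [[z Uz]|U0] := pselect (U !=set0).
  suff -> : [set x | exists2 y, U y & (~` val c `*` setT) (x, y)] = ~` val c.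
    exact: clopenC.
  by apply/seteqP; split=> x => [[y _ []]//|ncx]; exists z.
suff -> : [set x | exists2 y, U y & (~` val c `*` setT) (x, y)] = set0.
  exact: clopen0.
by rewrite -subset0 => x [y Uy _]; apply: U0; exists y.
Qed.

Definition cylinder c : CCR X := mk_CCR (@cocontinuous_cylinder c).

Lemma supremums_cylinder (D : set (set_type (@clopen X))) e :
  val e = closure (\bigcup_(d in D) val d) ->
  supremums (cylinder @` D) (cylinder e).
Proof.
move=> eE; split=> [_ [d Dd <-]|r ubr]; apply/le_CCR => -[x y] /= [].
  by move=> dx _; split=> //; rewrite eE; apply: subset_closure; exists d.
rewrite eE => + _; have [S cS rE] := CCR_cocontinuous r.
(* The domain of [S] is open. If it met the closure of the union, it would meet some [d] in [D],
   although [d] times [X] lies in the complement of [S]. *)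
have [oS _] := cS.2 setT clopenT.
move=> clx; rewrite rE => Sxy.
have [z [[d Dd dz] [w _ Szw]]] := clx [set z | exists2 w, setT w & S (z, w)]
  (open_nbhs_nbhs (conj oS (ex_intro2 _ _ y I Sxy))).
have /le_CCR := ubr (cylinder d) (ex_intro2 _ _ d Dd erefl).
by rewrite rE => /(_ (z, w) (conj dz I)).
Qed.

End Cylinders.

(** * Spatiality makes the isolated points dense *)

Section SpatialImpliesDense.
Context {X : topologicalType}.
Hypotheses (stoneX : stone_space X) (edX : extremally_disconnected X).

Let mk_clopen (U : set X) (cU : clopen U) : set_type (@clopen X) :=
  SigSub (mem_set cU).

Lemma spatial_dense_isolated (Y : topologicalType) (f : CCR X -> opens Y) :
  frame_isomorphism f -> dense (isolated_points X).
Proof.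
have [cptX hX bX] := stoneX.
move=> [[h fK _] [f_sup f_inf]] W [x0 Wx0] oW.
have [c0 [cc c0x0 c0W]] := nbhs_clopen bX (open_nbhs_nbhs (conj oW Wx0)).
(* [P y] is the family of clopen sets whose cylinders are sent to open sets containing [y]. [P_sup]
   is its complete primeness, whose empty case is [P_bot]. *)
pose P y c := val (f (cylinder c)) y.
have P_sup y (D : set (set_type (@clopen X))) e :
    val e = closure (\bigcup_(d in D) val d) ->
    P y e -> exists2 d, D d & P y d.
  move=> /supremums_cylinder /f_sup /supremums_opens; rewrite /P => ->.
  by move=> [_ [_ [d Dd <-] <-] fdy]; exists d.
pose bot := mk_clopen clopen0.
have P_bot y : ~ P y bot.
  by move=> /(P_sup y set0); rewrite bigcup_set0 closure0 => /(_ erefl) [].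
have P_disjoint y a b : val a `&` val b = set0 -> P y a -> P y b -> False.
  move=> ab0 Pa Pb; apply: (P_bot y).
  have /f_inf : infimums [set cylinder a; cylinder b] (cylinder bot).
    split=> [r _|r lbr]; apply/le_CCR => -[x z]; first by case.
    move=> rxz.
    have /le_CCR/(_ _ rxz)[/= ax _] := lbr (cylinder a) (or_introl erefl).
    have /le_CCR/(_ _ rxz)[/= bx _] := lbr (cylinder b) (or_intror erefl).
    by have : (val a `&` val b) x by []; rewrite ab0.
  rewrite image_setU !image_set1 => /(_ (finite_set2 _ _)) /infimums2_opens.
  by rewrite /P => ->.
pose c := mk_clopen cc.
(* Injectivity of [f] keeps the image of a nonempty cylinder nonempty. *)
have [y Py] : exists y, P y c.
  apply: contrapT => noP.
  have /(can_inj fK) : f (cylinder c) = f (cylinder bot).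
    apply/val_inj/seteqP; split=> y Py; first by case: noP; exists y.
    by case: (P_bot y).
  move=> /(congr1 val) /= cyl0.
  by have : (set0 `*` [set: X]) (x0, x0) by [rewrite -cyl0] => -[].
(* The join [e] of all clopen parts of [c0] outside [P y] is itself outside, by complete primeness.
   What remains, [c0] minus [e], will be the atom. *)
pose D := [set d | val d `<=` c0 /\ ~ P y d].
have ce : clopen (closure (\bigcup_(d in D) val d)).
  split; last exact: closed_closure.
  by apply/edX/bigcup_open => d _; case: (set_mem (valP d)).
pose e := mk_clopen ce.
have ec : val e `<=` c0.
  rewrite [X in _ `<=` X]((closure_id _).1 cc.2); apply: closureS.
  by move=> x [d [dc _] /dc].
have nPe : ~ P y e by move=> /(P_sup y D e erefl) [d []].
(* A part outside [P y] would belong to [D] and hence lie inside [e]. *)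
have P_sub d : val d `<=` c0 `\` val e -> val d !=set0 -> P y d.
  move=> dce [x dx]; apply: contrapT => nPd.
  have [cx] := dce _ dx; apply; apply: subset_closure; exists d => //.
  by split => // z /dce [].
have [z [c0z nez]] : c0 `\` val e !=set0.
  apply: contrapT => /nonemptyPn; rewrite setD_eq0 => ce0.
  apply: nPe; suff <- : c = e by [].
  by apply/val_inj/seteqP.
have ct : clopen (c0 `\` val e).
  by rewrite setDE; apply: clopenI => //; apply: clopenC.
exists z; split; first exact: c0W.
apply/isolated_pointsP; suff -> : [set z] = c0 `\` val e by case: ct.
apply/seteqP; split=> [_ -> //|w tw] /=; apply: contrapT => wz.
(* A second point [w] would let a clopen [a] split the remainder into two disjoint nonempty parts,
   both in [P y]. *)
have [|a [ca az aw]] := @nbhs_clopen _ bX z (~` [set w]).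
  apply: open_nbhs_nbhs; split; last by move=> /= zw; apply: wz.
  by rewrite openC; apply: accessible_closed_set1; exact: hausdorff_accessible.
have caI : clopen ((c0 `\` val e) `&` a) by exact: (clopenI ct ca).
have caD : clopen ((c0 `\` val e) `&` ~` a).
  exact: (clopenI ct (clopenC set0 ca)).
apply: (P_disjoint y (mk_clopen caI) (mk_clopen caD)).
- by rewrite -subset0 => x [[_ ax] [_ nax]].
- by apply: P_sub => [x []|] //; exists z.
- by apply: P_sub => [x []|] //; exists w; split => // /aw; exact.
Qed.

End SpatialImpliesDense.

(** * The Stone-Cech compactification of the isolated points *)

Lemma discrete_continuous (M : discreteTopologicalType) (Z : topologicalType)
  (f : M -> Z) : continuous f.
Proof.
by move=> m U /nbhs_singleton Um; apply: filterS (discrete_set1 m) => _ ->.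
Qed.

Lemma clopen_indicator_continuous (X : topologicalType) (U : set X) :
  clopen U -> continuous (fun x => x \in U).
Proof.
move=> [oU cU] x V /nbhs_singleton /= Vx.
have [xU|xU] := boolP (x \in U).
  apply: filterS (open_nbhs_nbhs (conj oU (set_mem xU))) => y Uy /=.
  by rewrite (mem_set Uy) -xU.
have oC : open (~` U) by rewrite openC.
apply: filterS (open_nbhs_nbhs (conj oC _)) => [y nUy /=|/mem_set];
  last exact/negP.
by rewrite (memNset nUy) -(negbTE xU).
Qed.

Lemma dense_continuous_unique (X Z : topologicalType) (A : set X)
    (g h : X -> Z) :
  dense A -> hausdorff_space Z -> continuous g -> continuous h ->
  {in A, g =1 h} -> g = h.
Proof.
move=> dA hZ cg ch gh; apply/funext => x; apply: hZ => U V nU nV.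
have ngU : nbhs x (g @^-1` U) by exact: cg.
have nhV : nbhs x (h @^-1` V) by exact: ch.
have : nbhs x (g @^-1` U `&` h @^-1` V) by exact: filterI.
rewrite nbhsE => -[B [oB Bx] BUV].
have [a [/BUV [/= Ua Va] /mem_set /gh ga]] := dA B (ex_intro _ x Bx) oB.
by exists (g a); split; rewrite // ga.
Qed.

(** The extension of [f] sends [x] to the limit of the filter [F x], generated by the images of the
    traces on [M] of the neighbourhoods of [x]. Compactness of [Z] gives a cluster point, and its
    uniqueness gives convergence. *)
Lemma dense_isolated_stone_cech (X : topologicalType) :
  compact [set: X] -> hausdorff_space X -> extremally_disconnected X ->
  dense (isolated_points X) ->
  is_stone_cech (val : discrete_topology (set_type (isolated_points X)) -> X).
Proof.
move=> cptX hX edX dX; split=> //; first exact: discrete_continuous.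
pose M := discrete_topology (set_type (isolated_points X)).
move=> Z f cptZ hZ _.
have dM (x : X) V : nbhs x V -> exists m : M, V (val m).
  rewrite nbhsE => -[U [oU Ux] UV].
  have [m [Um Im]] := dX U (ex_intro _ x Ux) oU.
  by exists (SigSub (mem_set Im)); exact: UV.
pose F (x : X) := filter_from (nbhs x) (fun V => f @` [set m : M | V (val m)]).
have PF x : ProperFilter (F x).
  apply: filter_from_proper; last first.
    by move=> V /dM [m Vm]; exists (f m); exists m.
  apply: filter_from_filter; first by exists setT; exact: filterT.
  move=> U V nU nV; exists (U `&` V); first exact: filterI.
  by move=> _ [m [Um Vm] <-]; split; exists m.
have F_image (x : X) V : nbhs x V -> F x (f @` [set m : M | V (val m)]).
  by exists V.
have F_cvg (x : X) : exists z : Z, F x --> z.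
  have [z [_ clz]] := cptZ _ (PF x) filterT.
  exists z; apply: (compact_cluster_set1 hZ cptZ) => //.
  - exact: filterT.
  - exact: filterT.
  apply/seteqP; split=> [w clw|_ -> //] /=; apply: contrapT => wz.
  have := hZ; rewrite open_hausdorff => /(_ w z) [|[A B] /=]; first exact/eqP.
  move=> [/set_mem Aw /set_mem Bz] [oA oB /eqP AB0].
  (* The points of M that f sends to A and to B are disjoint open sets, so
     they have disjoint closures because X is extremally disconnected. *)
  pose pre (C : set Z) := [set val m | m in f @^-1` C].
  have opre C : open (pre C).
    by apply: open_sub_isolated => _ [m _ <-]; exact: set_mem (valP m).
  have cl_pre C v : open C -> C v -> cluster (F x) v -> closure (pre C) x.
    move=> oC Cv clv V nV.
    have [_ [[m Vm <-] Cm]] :=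
      clv _ _ (F_image x V nV) (open_nbhs_nbhs (conj oC Cv)).
    by exists (val m); split => //; exists m.
  have /(_ (closure (pre A))) [|_ [[b Bb <-] clb]] := cl_pre B z oB Bz clz.
    apply: open_nbhs_nbhs; split; [exact/edX/opre|exact: cl_pre clw].
  have preBb : pre B (val b) by exists b.
  have [_ [[a Aa <-] /= [b' Bb' /val_inj ba]]] :=
    clb (pre B) (open_nbhs_nbhs (conj (opre B) preBb)).
  suff : (A `&` B) (f a) by rewrite AB0.
  by split=> //; rewrite -ba.
have [g Fg] := choice F_cvg.
have gf m : g (val m) = f m.
  apply/esym/hZ => U V nU nV; exists (f m); split; first exact: nbhs_singleton.
  have [W nW WV] := Fg (val m) V nV; apply: WV; exists m => //=.
  exact: nbhs_singleton.
have cg : continuous g.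
  move=> x U nU.
  (* Regularity provides [W] with closure inside [U]; for [y] near [x], the limit [g y] of values in
     [W] then stays in that closure. *)
  have [W nW WU] := compact_regular hZ cptZ (filterT : nbhs (g x) setT) nU.
  have [V0 nV0 VW] := Fg x W nW.
  have [V [oV Vx] VV0] : exists2 V, open_nbhs x V & V `<=` V0.
    by move: nV0; rewrite nbhsE.
  apply: filterS (open_nbhs_nbhs (conj oV Vx)) => y Vy; apply: WU => B nB.
  have [V' nV' VB] := Fg y B nB.
  have [m [Vm V'm]] := dM y _ (filterI (open_nbhs_nbhs (conj oV Vy)) nV').
  exists (f m); split; last by apply: VB; exists m.
  by apply: VW; exists m => //; exact: VV0.
exists g; split; first by split => //; exact/funext.
move=> h [ch hf]; apply: (dense_continuous_unique dX hZ cg ch) => x /set_mem Ix.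
have -> : x = val (SigSub (mem_set Ix) : M) by [].
by rewrite gf -hf.
Qed.

Lemma homeomorphic_stone_cech (T K X : topologicalType) (i : T -> K)
    (f : X -> K) (g : K -> X) :
  compact [set: X] -> hausdorff_space X ->
  cancel f g -> cancel g f -> continuous f -> continuous g ->
  is_stone_cech i -> is_stone_cech (g \o i).
Proof.
move=> cptX hX fK gK cf cg [_ _ ci univ]; split => //.
  by move=> m; apply: continuous_comp; [exact: ci | exact: cg].
move=> Z h cptZ hZ ch; have [k [[ck kh] k_unique]] := univ Z h cptZ hZ ch.
exists (k \o f); split.
  split; first by move=> x; apply: continuous_comp; [exact: cf | exact: ck].
  by rewrite -kh; apply/funext => m /=; rewrite gK.
move=> k' [ck' k'h]; rewrite (k_unique (k' \o g)).
  by apply/funext => x /=; rewrite fK.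
by split => // x; apply: continuous_comp; [exact: cg | exact: ck'].
Qed.

Lemma stone_cech_dense_isolated (M : choiceType) (X : topologicalType)
    (i : discrete_topology M -> X) :
  basis [set U : set X | clopen U] -> is_stone_cech i ->
  dense (isolated_points X).
Proof.
move=> bX [cptX hX ci univ].
have univ_bool (h : discrete_topology M -> bool) :
    exists! g : X -> bool, continuous g /\ g \o i = h.
  apply: univ; [exact: bool_compact | exact: discrete_hausdorff |].
  exact: discrete_continuous.
(* If a clopen [U] missed the range, its indicator and the constant [false] would be two extensions
   of the same map. *)
have d_range : dense (range i).
  move=> W [x Wx] oW; apply: contrapT => Wi.
  have [U [cU Ux UW]] := nbhs_clopen bX (open_nbhs_nbhs (conj oW Wx)).
  have [k [_ k_unique]] := univ_bool (fun=> false).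
  have kU : k = (fun x => x \in U).
    apply: k_unique; split; first exact: clopen_indicator_continuous.
    apply/funext => m /=; apply/negbTE/negP => /set_mem Uim.
    by apply: Wi; exists (i m); split; [exact: UW | exists m].
  have kF : k = (fun=> false).
    by apply: k_unique; split => //; exact: cst_continuous.
  by have := congr1 (@^~ x) kF; rewrite kU /= mem_set.
move=> W W0 oW; have [x [Wx [m _ imx]]] := d_range W W0 oW; subst x.
exists (i m); split => //; apply/isolated_pointsP.
(* The open set where [k] is true meets the range only in [i m]. Removing that point leaves an open
   set missing the dense range, hence empty. *)
have [k [[/continuousP ck ki] _]] := univ_bool (fun n => n == m).
have kim n : k (i n) = (n == m) by rewrite -[LHS]/((k \o i) n) ki.
suff -> : [set i m] = k @^-1` [set true] by apply: ck; exact: discrete_open.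
apply/seteqP; split=> [_ -> /=|x kx] /=; first by rewrite kim eqxx.
apply: contrapT => xim.
have [||x' [[kn nim] [n _ nE]]] :=
  d_range (k @^-1` [set true] `&` ~` [set i m]).
- by exists x.
- apply: openI; first by apply: ck; exact: discrete_open.
  by rewrite openC; apply: accessible_closed_set1; exact: hausdorff_accessible.
by apply: nim; move: kn; rewrite -nE /= kim => /eqP ->.
Qed.

Theorem theorem3p9 (X : topologicalType)
    (stoneX : stone_space X) (edX : extremally_disconnected X) :
  (spatial_frame (CCR X) <-> dense (isolated_points X)) /\
  (dense (isolated_points X) <->
   exists (M : choiceType) (betaM : topologicalType)
     (i : discrete_topology M -> betaM),
     is_stone_cech i /\ homeomorphic X betaM).
Proof.
have [cptX hX bX] := stoneX.
split; split.
- by move=> [_ [Y [f f_iso]]]; exact: (spatial_dense_isolated stoneX edX f_iso).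
- exact: dense_isolated_spatial.
- move=> dX; exists (set_type (isolated_points X)), X, val; split.
    exact: dense_isolated_stone_cech.
  by exists id, id; split => // x; exact: cvg_id.
- move=> [M [K [i [iM [f [g [fK gK cf cg]]]]]]].
  apply: stone_cech_dense_isolated bX _.
  exact: (homeomorphic_stone_cech cptX hX fK gK cf cg iM).
Qed.
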